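(* Let $\mathcal{A}$ be an alphabet with $b\geq 2$ symbols, and let $k$ and $n$ be positive integers. The number of $(k,n)$-perfect necklaces over $\mathcal{A}$ is \[ \frac{1}{n}\sum_{d_{b,n}\mid j\mid n} e(j)\,\varphi(n/j), \] where the sum ranges over the positive integers $j$ with $d_{b,n}\mid j$ and $j\mid n$, $e(j)=(b!)^{j b^{k-1}}\, b^{-k}$ (which is the number of Eulerian circuits in the astute graph $G_{k-1,j}$), and $\varphi$ is Euler's totient function.
   Context: A word is a finite sequence of symbols of $\mathcal{A}$; positions in a word $w$ are numbered $0,\dots,|w|-1$. A necklace is the equivalence class of a word under cyclic rotations. A word $u$ of length $k$ occurs in a necklace $[s]$ (with $|s|=N$) at position $i$ if $s((i+t)\bmod N)=u(t)$ for $t=0,\dots,k-1$. A necklace is $(k,n)$-perfect if it has length $n|\mathcal{A}|^k$ and each word of length $k$ occurs in it exactly $n$ times, at positions that are pairwise different modulo $n$ (this does not depend on the choice of starting point since $n$ divides the length). For positive integers $m,n$, $d_{m,n}=\prod_i p_i^{\alpha_i}$, where $\{p_i\}$ is the set of primes dividing $m$ and $\alpha_i$ is the exponent of $p_i$ in the prime factorization of $n$. The astute graph $G_{s,j}$ is the directed multigraph whose nodes are pairs $(u,v)$ with $u\in\mathcal{A}^s$ and $v\in\{0,\dots,j-1\}$, with one edge for each $w\in\mathcal{A}^{s+1}$ and $v\in\{0,\dots,j-1\}$, going from $(w(0\ldots s-1),v)$ to $(w(1\ldots s),(v+1)\bmod j)$ (for $s=0$ there are $b$ edges from $(\lambda,v)$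 to $(\lambda,(v+1)\bmod j)$, $\lambda$ the empty word). *)

(* Defs.v *)
From mathcomp Require Import all_boot all_order all_algebra.

Set Implicit Arguments.
Unset Strict Implicit.
Unset Printing Implicit Defensive.

Import GRing.Theory.

Section Necklaces.

Variable A : finType.

Definition rotation_equiv (N : nat) : rel (N.-tuple A) :=
  fun s t => [exists i : 'I_N.+1, rot i s == t :> seq A].

Definition necklaces (N : nat) : {set {set N.-tuple A}} :=
  equivalence_partition (@rotation_equiv N) [set: N.-tuple A].

(* [onth] dispenses with a default letter; as [i < N], both sides are always
   of the form [Some _]. *)
Definition occurs_at (k N : nat) (u : k.-tuple A) (s : N.-tuple A) (i : 'I_N) :
    bool :=
  [forall t : 'I_k, onth s ((i + t) %% N) == onth u t].

Definition occurrences (k N : nat) (u : k.-tuple A) (s : N.-tuple A) :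
    {set 'I_N} :=
  [set i | occurs_at u s i].

Definition perfect_word (k n N : nat) (s : N.-tuple A) : bool :=
  [forall u : k.-tuple A,
     (#|occurrences u s| == n) &&
     [forall i in occurrences u s, forall j in occurrences u s,
        (i != j) ==> (i != j %[mod n])]].

Definition perfect_necklaces (k n : nat) :
    {set {set (n * #|A| ^ k).-tuple A}} :=
  [set X in necklaces (n * #|A| ^ k) | [forall s in X, perfect_word k n s]].

End Necklaces.

Record multidigraph := MultiDigraph {
  node : finType;
  edge : finType;
  source : edge -> node;
  target : edge -> node
}.

Definition eulerian_tour (G : multidigraph) (c : #|edge G|.-tuple (edge G)) :
    bool :=
  [forall e : edge G, count_mem e c == 1] &&
  cycle (fun e f => target e == source f) c.

(* An Eulerian circuit has no distinguished first edge: it is a class of closed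
   edge sequences under rotation. Parallel edges are distinct. *)
Definition eulerian_circuits (G : multidigraph) :
    {set {set #|edge G|.-tuple (edge G)}} :=
  [set X in necklaces (edge G) #|edge G| | [forall c in X, eulerian_tour c]].

Definition astute_graph (A : finType) (s j : nat) : multidigraph :=
  @MultiDigraph (s.-tuple A * 'I_j)%type (s.+1.-tuple A * 'I_j)%type
    (fun e => ([tuple tnth e.1 (widen_ord (leqnSn s) i) | i < s], e.2))
    (fun e => ([tuple tnth e.1 (lift ord0 i) | i < s], ordS e.2)).

Definition d_part (m n : nat) : nat := \prod_(p <- primes m) p ^ logn p n.

Definition e_num (b k j : nat) : rat :=
  ((b`!)%:R ^+ (j * b ^ k.-1) / b%:R ^+ k)%R.

(* Main.v *)
Require Import Defs.
From mathcomp Require Import all_boot all_order all_algebra all_fingroup.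

Set Implicit Arguments.
Unset Strict Implicit.
Unset Printing Implicit Defensive.

Import GRing.Theory Num.Theory.

(** A closed walk using every edge of [G_(k-1,j)] once is a permutation [s] of
    the edges with [source (s e) = target e] that has a single orbit. For any
    permutation matrix [P_s] of size [m] and the matrix [C] whose column [r] is
    constantly 1 (and whose other entries are 0), [det (1 - P_s + C)] is [m] if
    [s] is a single cycle and 0 otherwise. Averaging this determinant over the
    [(b!)^(j b^(k-1))] permutations compatible with the graph amounts to
    replacing [P_s] by its average [Q], the random walk on words of length [k],
    so that no tree counting is needed. Now [Q] is the product [U W] of "drop
    the first letter" and "append a random letter", and [W U] is the random walk
    on words of length [k-1]; as [det (1 - U W) = det (1 - W U)], the determinant
    is the one for the empty word, namely [j]. Hence there are
    [(b!)^(j b^(k-1)) b^(-k)] circuits, and [(b!)^(j b^(k-1))] words that are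
    [(k,j)]-perfect, since these are the tours starting in the layer 0.

    Necklaces are counted by Burnside's lemma. If a [(k,n)]-perfect word of
    length [N = n b^k] is fixed by the rotation by [r] and [g = gcd (r, N)], the
    word read at the position [lcm (n, g)] is the one read at 0, whence
    [lcm (n, g) = N]; then [g = j b^k] with [j = gcd (n, g)], and the fixed
    perfect words are the powers of the [(k,j)]-perfect ones. *)

(** * Determinants and transition systems *)

Section Determinants.

Local Open Scope ring_scope.

(** Enumerating the orbit backwards from [r] puts the ones of [perm_mx s] just below the diagonal,
    apart from the one in the first row. The columns of [1%:M - perm_mx s] sum to 0, so adding all
    rows to the first leaves there a single entry [m], in the column of [r]. The result is
    triangular with diagonal [m, 1, ..., 1]. *)
Lemma det_cyclic_perm (R : comNzRingType) (m : nat) (s : 'S_m) (r : 'I_m) :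
  porbit s r = [set: 'I_m] ->
  \det (1%:M - perm_mx s + \matrix_(i, j) (j == r)%:R) = m%:R :> R.
Proof.
case: m s r => [|m] s r; first by case: r.
move=> sr; set X := (X in \det X).
pose p i := iter i (s^-1)%g r.
have p_inj : injective (fun i : 'I_m.+1 => p i).
  have := uniq_traject_porbit (s^-1)%g r.
  rewrite porbitV sr cardsT card_ord => /uniqP => /(_ r) pU i j eq_p.
  apply/val_inj/pU; rewrite ?inE ?size_traject; try exact: ltn_ord.
  by rewrite !nth_traject //; exact: ltn_ord.
pose q : 'S_m.+1 := perm p_inj.
(* Left multiplication by [K] replaces the first row by the sum of all rows. *)
pose K : 'M[R]_m.+1 := \matrix_(i, j) if i == ord0 then 1 else (i == j)%:R.
have detK : \det K = 1.
  rewrite -det_tr det_trig.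
    by rewrite big1 // => i _; rewrite !mxE eqxx; case: eqP.
  apply/is_trig_mxP => i j lt_ij; rewrite !mxE.
  case: eqP lt_ij => [->|_] lt_ij; first by rewrite ltn0 in lt_ij.
  by case: eqP lt_ij => // ->; rewrite ltnn.
pose Y := col_perm q (row_perm q X).
have detY : \det Y = \det X.
  rewrite /Y col_permE row_permE !det_mulmx !det_perm odd_permV mulrAC.
  by rewrite -signr_addb addbb mul1r.
have YE i j : Y i j = (i == j)%:R - (s (p i) == p j)%:R + (j == ord0)%:R.
  have p0 : (p j == r) = (j == ord0) := inj_eq p_inj j ord0.
  by rewrite !mxE !permE (inj_eq p_inj) p0.
have sumY j : \sum_i Y i j = (j == ord0)%:R *+ m.+1.
  under eq_bigr do rewrite YE.
  rewrite !big_split /= sumrN.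
  rewrite (bigD1 j) //= eqxx big1 ?addr0; last by move=> i /negPf->.
  have -> : \sum_(i : 'I_m.+1) (s (p i) == p j)%:R = 1 :> R.
    pose i0 : 'I_m.+1 := (q^-1)%g ((s^-1)%g (p j)).
    have qi0 : p i0 = (s^-1)%g (p j) by rewrite -(permE p_inj) permKV.
    rewrite (bigD1 i0) //= qi0 permKV eqxx big1 ?addr0 // => i ne_i.
    case: eqP => // e; case/eqP: ne_i; apply/p_inj; rewrite qi0.
    by rewrite -e permK.
  by rewrite subrr add0r sumr_const card_ord.
rewrite -detY -[\det Y]mul1r -[X in X * _]detK -det_mulmx.
have ZE i j : (K *m Y) i j =
    if i == ord0 then (j == ord0)%:R *+ m.+1 else Y i j.
  rewrite mxE; case: eqP => [->|/eqP ne_i0].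
    by rewrite -sumY; apply: eq_bigr => l _; rewrite mxE eqxx mul1r.
  rewrite (bigD1 i) //= mxE (negPf ne_i0) eqxx mul1r big1 ?addr0 // => l ne_l.
  by rewrite mxE (negPf ne_i0) eq_sym (negPf ne_l) mul0r.
have sp (i : 'I_m) (j : 'I_m.+1) :
    (s (p (lift ord0 i)) == p j) = (widen_ord (leqnSn m) i == j).
  by rewrite lift0 /p iterS permKV -/(p (widen_ord (leqnSn m) i)) (inj_eq p_inj).
rewrite det_trig.
  rewrite big_ord_recl ZE /= mulr1n big1 ?mulr1 // => i _.
  rewrite ZE YE sp eqxx -val_eqE /= -[in X in _ - X]val_eqE /=.
  by rewrite /bump /= add1n ltn_eqF // subr0 addr0.
apply/is_trig_mxP => i j lt_ij; rewrite ZE.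
have ne_j0 : (j == ord0) = false.
  by apply/eqP => ej; rewrite ej ltn0 in lt_ij.
rewrite ne_j0 mul0rn; case: eqP => // /eqP ne_i0.
have [l el] : exists l, i = lift ord0 l 
  by case: (unliftP ord0 i) ne_i0 => [l|] ->; [exists l | rewrite eqxx].
rewrite YE el sp ne_j0 addr0 -!val_eqE -el /= (ltn_eqF lt_ij) ltn_eqF ?subrr //.
by move: lt_ij; rewrite el lift0; apply: ltn_trans.
Qed.

(** The indicator of the complement of the orbit of [r] is a nonzero kernel vector: being constant
    on orbits it is killed by [1%:M - perm_mx s], and vanishing at [r] it is killed by the rank-one
    term. *)
Lemma det_noncyclic_perm (R : idomainType) (m : nat) (s : 'S_m) (r : 'I_m) :
  porbit s r != [set: 'I_m] ->
  \det (1%:M - perm_mx s + \matrix_(i, j) (j == r)%:R) = 0 :> R.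
Proof.
move=> sr; apply/eqP; rewrite -det_tr; apply/det0P.
exists (\row_i (i \notin porbit s r)%:R).
  apply/eqP => /rowP z0; case/eqP: sr; apply/setP => i; rewrite inE.
  move: (z0 i); rewrite !mxE; case: (i \in _) => //= /eqP.
  by rewrite oner_eq0.
apply/rowP => i; rewrite !mxE.
transitivity (\sum_j (j \notin porbit s r)%:R * ((i == j)%:R - (s i == j)%:R
   + (j == r)%:R) : R).
  by apply: eq_bigr => j _; rewrite !mxE.
under eq_bigr do rewrite mulrDr mulrBr.
rewrite !big_split /= sumrN.
rewrite (bigD1 i) //= eqxx mulr1 big1 ?addr0; last first.
  by move=> j /negPf ne_j; rewrite eq_sym ne_j mulr0.
rewrite (bigD1 (s i)) //= eqxx mulr1 big1 ?addr0; last first.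
  by move=> j /negPf ne_j; rewrite eq_sym ne_j mulr0.
rewrite big1 ?addr0; last first.
  by move=> j _; case: eqP => [->|_]; rewrite ?porbit_id ?mul0r ?mulr0.
have -> : (s i \in porbit s r) = (i \in porbit s r).
  have := mem_porbit s 1 i; rewrite expg1 -eq_porbit_mem => /eqP e.
  by rewrite -!eq_porbit_mem e.
by rewrite subrr.
Qed.

(** Sylvester's identity: the block matrix with blocks [1, U, W, 1] factors into block triangular
    matrices in two ways. *)
Lemma det1_subC (R : comPzRingType) (m n : nat) (U : 'M[R]_(m, n)) (W : 'M[R]_(n, m)) :
  \det (1%:M - U *m W) = \det (1%:M - W *m U).
Proof.
have := erefl (\det (block_mx 1%:M U W 1%:M)).
have {1}-> : block_mx 1%:M U W 1%:M =
    block_mx 1%:M 0 W 1%:M *m block_mx 1%:M U 0 (1%:M - W *m U).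
  rewrite mulmx_block !mul1mx !mulmx1 !mul0mx !addr0.
  by rewrite [W *m U + _]addrC subrK.
have -> : block_mx 1%:M U W 1%:M =
    block_mx (1%:M - U *m W) U 0 1%:M *m block_mx 1%:M 0 W 1%:M.
  rewrite mulmx_block !mul1mx !mulmx1 !mul0mx !mulmx0 !add0r.
  by rewrite subrK.
by rewrite !det_mulmx !det_ublock !det_lblock !det1 !mul1r !mulr1 => ->.
Qed.

(** Multilinearity in the rows, fully expanded; [S] records the rows taken from [B]. *)
Lemma det_addmx_rows (R : comPzRingType) (m : nat) (A B : 'M[R]_m) :
  \det (A + B) =
  \sum_(S : {set 'I_m}) \det (\matrix_(i, j) if i \in S then B i j else A i j).
Proof.
rewrite /determinant exchange_big /=; apply: eq_bigr => t _.
rewrite -big_distrr /=; congr (_ * _).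
under eq_bigr do rewrite mxE addrC.
rewrite bigA_distr; apply: eq_bigr => S _; apply: eq_bigr => i _.
by rewrite !mxE.
Qed.

(** * Averaging determinants over transition systems *)

Section Average.

Variables (F : numFieldType) (m b : nat) (V : finType) (src tgt : 'I_m -> V).
Hypotheses (b_gt0 : (0 < b)%N) (outdeg : forall x, #|[set i | src i == x]| = b).

(** These are the transition systems of a directed graph: each edge is continued bijectively by an
    edge leaving its target, so the cycles of [s] split the edges into closed walks. *)
Definition transitions : {set 'S_m} := [set s : 'S_m | [forall i, src (s i) == tgt i]].

Lemma transitionsP (s : 'S_m) :
  reflect (forall i, src (s i) = tgt i) (s \in transitions).
Proof. by rewrite inE; apply: 'forall_eqP. Qed.

(** Edges entering distinct nodes are continued independently, each uniformly among the [b] edges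
    leaving its target. *)
Lemma sum_transitions_prescribed (f : 'I_m -> 'I_m) (l : seq 'I_m) :
  uniq (map tgt l) ->
  \sum_(s in transitions) \prod_(i <- l) (s i == f i)%:R =
  #|transitions|%:R * \prod_(i <- l) ((src (f i) == tgt i)%:R / b%:R) :> F.
Proof.
have bF : b%:R != 0 :> F by rewrite pnatr_eq0 -lt0n.
elim: l => [|i l IHl] /=.
  by move=> _; rewrite big_nil mulr1 -sumr_const; under eq_bigr do rewrite big_nil.
case/andP=> i_l /IHl {}IHl; rewrite big_cons mulrCA -IHl.
under eq_bigr do rewrite big_cons.
have [fi|fi] := eqVneq (src (f i)) (tgt i); last first.
  rewrite mul0r mul0r big1 // => s /transitionsP s_t.
  by case: eqP => [sf|]; rewrite ?mul0r // -sf s_t eqxx in fi *.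
apply: (mulfI bF); rewrite mulrA mul1r divff // mul1r.
pose g y := \sum_(s in transitions) (s i == y)%:R * \prod_(j <- l) (s j == f j)%:R : F.
(* Both [y] and [f i] leave the node [tgt i], so swapping them after [s] preserves transition
   systems. The edges chosen after the members of [l] leave other nodes and are not moved. *)
have gE y : src y = tgt i -> g y = g (f i).
  move=> yi; rewrite /g (reindex_inj (mulIg (tperm y (f i)))) /=.
  have tr s : ((s * tperm y (f i))%g \in transitions) = (s \in transitions).
    have src_t z : src (tperm y (f i) z) = src z.
      by case: tpermP => // ->; rewrite yi fi.
    by apply/transitionsP/transitionsP => H j; move: (H j); rewrite permM src_t.
  rewrite (eq_bigl _ _ tr); apply: eq_bigr => s /transitionsP s_t.
  congr (_ * _).
    by rewrite permM (can2_eq (tpermK _ _) (tpermK _ _)) tpermL.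
  rewrite !big_seq; apply: eq_bigr => j jl; rewrite permM tpermD //.
    by apply: contraNneq i_l => e; rewrite -yi e s_t map_f.
  by apply: contraNneq i_l => e; rewrite -fi e s_t map_f.
(* Each [s] sends [i] to exactly one of the [b] edges leaving [tgt i], so these [b] equal sums add
   up to the sum without the condition at [i]. *)
transitivity (\sum_(y in [set y | src y == tgt i]) g y).
  rewrite [RHS](eq_bigr (fun=> g (f i))); last first.
    by move=> y; rewrite inE => /eqP yi; rewrite (gE _ yi).
  by rewrite sumr_const outdeg mulr_natl.
rewrite exchange_big /=; apply: eq_bigr => s /transitionsP s_t.
rewrite -big_distrl /= (bigD1 (s i)) ?inE ?s_t //= eqxx big1 ?addr0 ?mul1r //.
by move=> y /andP[_ /negPf]; rewrite eq_sym => ->.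
Qed.

(* Among the rows taken from the permutation matrices, two with the same target
   cancel under a swap; otherwise these rows are independent and uniform. *)
Lemma sum_det_transitions (A : 'M[F]_m) :
  \sum_(s in transitions) \det (A - perm_mx s) =
  #|transitions|%:R *
    \det (A - \matrix_(i, j) ((src j == tgt i)%:R / b%:R)).
Proof.
under eq_bigr do rewrite det_addmx_rows.
rewrite exchange_big det_addmx_rows mulr_sumr /=; apply: eq_bigr => S _.
have [tgt_inj|] := boolP (uniq (map tgt (enum S))).
  rewrite /determinant exchange_big mulr_sumr /=; apply: eq_bigr => t _.
  rewrite -big_distrr mulrCA /=; congr (_ * _).
  (* [C] gathers what does not depend on [s]: the signs and the entries of the rows outside [S]. *)
  pose C := \prod_i (if i \in S then -1 else A i (t i)).
  have splitC (G : 'I_m -> F) :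
      \prod_i (if i \in S then - G i else A i (t i)) = C * \prod_(i <- enum S) G i.
    rewrite big_enum [X in C * X]big_mkcond -big_split /=.
    by apply: eq_bigr => i _; case: ifP; rewrite ?mulN1r ?mulr1.
  transitivity (\sum_(s in transitions) C * \prod_(i <- enum S) (s i == t i)%:R).
    apply: eq_bigr => s _; rewrite -splitC; apply: eq_bigr => i _.
    by rewrite !mxE.
  rewrite -mulr_sumr sum_transitions_prescribed // mulrCA -splitC.
  by congr (_ * _); apply: eq_bigr => i _; rewrite !mxE.
case/dinjectivePn => i Si [j /andP[/= ne_ji Sj] tij].
rewrite [X in _ = _ * X](determinant_alternate (i1 := i) (i2 := j)).
- rewrite mulr0.
  pose d (s : 'S_m) :=
    \det (\matrix_(x, y) if x \in S then (- perm_mx s : 'M[F]_m) x y else A x y).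
  change (\sum_(s in transitions) d s = 0).
  pose t := tperm i j.
  suff e : \sum_(s in transitions) d s = - \sum_(s in transitions) d s.
    by apply/eqP; rewrite -[_ == 0](mulrn_eq0 _ 2) mulr2n {1}e addNr eqxx.
  rewrite {1}(reindex_inj (mulgI t)) -sumrN.
  have tr s : ((t * s)%g \in transitions) = (s \in transitions).
    have tgt_t z : tgt (t z) = tgt z by rewrite /t; case: tpermP => // ->.
    apply/transitionsP/transitionsP => H z.
      by move: (H (t z)); rewrite permM tpermK tgt_t.
    by rewrite permM H tgt_t.
  rewrite (eq_bigl _ _ tr); apply: eq_bigr => s _; rewrite /d.
  have sgn : \det (perm_mx t) = -1 :> F.
    by rewrite det_perm odd_tperm eq_sym ne_ji expr1.
  rewrite -[RHS]mulN1r -[X in _ = X * _]sgn -det_mulmx -row_permE; congr (\det _).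
  apply/matrixP => x y; rewrite !mxE.
  have -> : (t x \in S) = (x \in S).
    by rewrite /t; case: tpermP => // ->; rewrite Si Sj.
  case: ifP => xS; first by rewrite permM.
  by rewrite /t tpermD //; apply: contraFneq xS => <-.
- by rewrite eq_sym.
by move=> x; rewrite !mxE Si Sj tij.
Qed.

(* Every other transition system contributes a singular matrix. *)
Lemma card_cyclic_transitions (r : 'I_m) :
  #|[set s in transitions | porbit s r == [set: 'I_m]]|%:R * m%:R =
  #|transitions|%:R * \det (1%:M - \matrix_(i, j) ((src j == tgt i)%:R / b%:R)
                            + \matrix_(i, j) (j == r)%:R) :> F.
Proof.
rewrite addrAC -sum_det_transitions (bigID (fun s => porbit s r == setT)) /=.
rewrite [X in _ + X]big1 ?addr0; last first.
  by move=> s /andP[_ sr]; rewrite addrAC det_noncyclic_perm.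
rewrite (eq_bigr (fun=> m%:R)); last first.
  by move=> s /andP[_ /eqP sr]; rewrite addrAC det_cyclic_perm.
rewrite sumr_const mulr_natl; congr (_ *+ _); apply: eq_card => s.
by rewrite !inE unfold_in inE.
Qed.

End Average.

End Determinants.

(** * Random walks on words *)

Section CountTransitions.

Variables (m : nat) (V L : finType) (src tgt : 'I_m -> V).
Variables (inn out : V -> L -> 'I_m) (lin lout : 'I_m -> L).
Hypotheses (tgt_inn : forall x a, tgt (inn x a) = x)
  (lin_inn : forall x a, lin (inn x a) = a)
  (inn_lin : forall i, inn (tgt i) (lin i) = i).
Hypotheses (src_out : forall x a, src (out x a) = x)
  (lout_out : forall x a, lout (out x a) = a)
  (out_lout : forall i, out (src i) (lout i) = i).

Lemma card_out_fiber x : #|[set i | src i == x]| = #|L|.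
Proof.
have out_inj : injective (out x).
  by move=> a c e; rewrite -(lout_out x a) e lout_out.
rewrite -(card_imset predT out_inj); apply: eq_card => i.
rewrite inE; apply/eqP/imsetP => [<-|[a _ ->]]; last exact: src_out.
by exists (lout i).
Qed.

(** A transition system is an independent choice, at each node, of a bijection from incoming to
    outgoing edges; the labels [lin] and [lout] turn it into a permutation of [L]. *)
Lemma card_transitions : #|transitions src tgt| = #|L|`! ^ #|V|.
Proof.
have cardL : #|{perm L}| = #|L|`!.
  rewrite -cardsT -(card_perm [set: L]); apply: eq_card => s.
  by rewrite inE; apply/esym/subsetP => a _; rewrite inE.
pose f (h : {ffun V -> {perm L}}) i := out (tgt i) (h (tgt i) (lin i)).
have f_inj h : injective (f h).
  move=> i j e; have et : tgt i = tgt j.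
    by have := congr1 src e; rewrite /f !src_out.
  have := congr1 lout e; rewrite /f !lout_out et => /perm_inj el.
  by rewrite -(inn_lin i) -(inn_lin j) et el.
pose g h := perm (f_inj h).
have g_inj : injective g.
  move=> h h' e; apply/ffunP => x; apply/permP => a.
  have := congr1 (fun s : 'S_m => lout (s (inn x a))) e.
  by rewrite !permE /f !lout_out tgt_inn lin_inn.
rewrite -cardL -card_ffun -(card_imset predT g_inj).
apply: eq_card => s; apply/transitionsP/imsetP => [s_t|[h _ ->] i]; last first.
  by rewrite permE /f src_out.
have s_inj x : injective (fun a => lout (s (inn x a))).
  move=> a c e; rewrite -(lin_inn x a) -(lin_inn x c); congr lin.
  by apply: (@perm_inj _ s); rewrite -(out_lout (s (inn x a))) -(out_lout (s (inn x c)))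
     !s_t !tgt_inn e.
exists [ffun x => perm (s_inj x)] => //; apply/permP => i.
by rewrite permE /f ffunE permE inn_lin -s_t out_lout.
Qed.

End CountTransitions.

(** * Removing the first or the last letter *)

Section Words.

Variable A : finType.

(** [wbehead] and [wbelast] copy the formulas for [target] and [source] in [astute_graph], so that
    they match by conversion. *)
Definition wbehead k (w : k.+1.-tuple A) : k.-tuple A :=
  [tuple tnth w (lift ord0 i) | i < k].

Definition wbelast k (w : k.+1.-tuple A) : k.-tuple A :=
  [tuple tnth w (widen_ord (leqnSn k) i) | i < k].

Definition wlast k (w : k.+1.-tuple A) : A := tnth w ord_max.

Lemma wbehead_cons k a (u : k.-tuple A) : wbehead [tuple of a :: u] = u.
Proof.
apply: eq_from_tnth => i; rewrite tnth_mktuple !(tnth_nth a) lift0 //.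
Qed.

Lemma cons_wbehead k (w : k.+1.-tuple A) : [tuple of thead w :: wbehead w] = w.
Proof.
apply: eq_from_tnth => i; case: (unliftP ord0 i) => [j|] ->.
  transitivity (tnth (wbehead w) j); last by rewrite tnth_mktuple.
  by rewrite !(tnth_nth (thead w)) lift0.
by rewrite [LHS](tnth_nth (thead w)).
Qed.

Lemma wbelast_rcons k a (u : k.-tuple A) : wbelast [tuple of rcons u a] = u.
Proof.
apply: eq_from_tnth => i; rewrite tnth_mktuple (tnth_nth a) /=.
by rewrite nth_rcons size_tuple ltn_ord -tnth_nth.
Qed.

Lemma wlast_rcons k a (u : k.-tuple A) : wlast [tuple of rcons u a] = a.
Proof.
by rewrite /wlast (tnth_nth a) /= nth_rcons size_tuple ltnn eqxx.
Qed.

Lemma rcons_wbelast k (w : k.+1.-tuple A) : [tuple of rcons (wbelast w) (wlast w)] = w.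
Proof.
apply: eq_from_tnth => i; rewrite (tnth_nth (wlast w)) [LHS]nth_rcons.
rewrite (size_tuple (wbelast w)).
case: ltngtP => [lt_ik|lt_ki|e].
- transitivity (tnth (wbelast w) (Ordinal lt_ik)).
    by rewrite (tnth_nth (wlast w)).
  by rewrite tnth_mktuple; congr tnth; apply: val_inj.
- by have := ltn_ord i; rewrite ltnS leqNgt lt_ki.
by rewrite /wlast; congr tnth; apply: val_inj.
Qed.

Lemma wbelast_cons k a (u : k.+1.-tuple A) :
  wbelast [tuple of a :: u] = [tuple of a :: wbelast u].
Proof.
apply: eq_from_tnth => i; rewrite tnth_mktuple.
case: (unliftP ord0 i) => [j|] ->; last by rewrite !(tnth_nth a).
transitivity (tnth (wbelast u) j); last by rewrite !(tnth_nth a) lift0.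
by rewrite tnth_mktuple !(tnth_nth a).
Qed.

Lemma wbelast_behead k (w : k.+2.-tuple A) : wbelast (wbehead w) = wbehead (wbelast w).
Proof. by rewrite -{2}(cons_wbehead w) wbelast_cons wbehead_cons. Qed.

(** Overlapping words glue in exactly one way, so an entry of the shortened walk matrix counts at
    most one word. *)
Lemma wbelast_wbehead_eq k (x y : k.+1.-tuple A) (z : k.+2.-tuple A) :
  wbelast y = wbehead x ->
  (wbelast z == x) && (wbehead z == y) = (z == [tuple of thead x :: y]).
Proof.
move=> exy; apply/andP/eqP => [[/eqP<- /eqP<-]|->].
  rewrite -{1}(cons_wbehead z); congr [tuple of _ :: _].
  by rewrite -{2}(cons_wbehead z) wbelast_cons theadE.
by rewrite wbehead_cons wbelast_cons exy cons_wbehead !eqxx.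
Qed.

End Words.

(** * The determinant of the random walk on words *)

Section Shift.

Variables (A : finType) (j : nat).
Hypothesis A_gt0 : 0 < #|A|.

Notation edges k := {: k.-tuple A * 'I_j}.

Local Open Scope ring_scope.

Lemma sum_enum_val (T : finType) (R : nmodType) (F : T -> R) :
  \sum_(i < #|T|) F (enum_val i) = \sum_x F x.
Proof. by rewrite -(big_enum_val F). Qed.

Lemma val_iter_ordS (i : nat) (v : 'I_j) : val (iter i (@ordS j) v) = ((v + i) %% j)%N.
Proof.
elim: i => [|i IHi] /=; first by rewrite addn0 modn_small.
by rewrite IHi -addn1 modnDml addn1 addnS.
Qed.

(** Without letters the walk is the shift of the [j] layers, a single cycle, and [det_cyclic_perm]
    applies. *)
Lemma det_shift0 (r : 'I_#|edges 0|) :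
  \det (1%:M - \matrix_(x, y) ((enum_val y).2 == ordS (enum_val x).2)%:R
         + \matrix_(x, y) (y == r)%:R : 'M[rat]_#|edges 0|) = j%:R.
Proof.
pose f (x : 'I_#|edges 0|) : 'I_#|edges 0| :=
  enum_rank ((enum_val x).1, ordS (enum_val x).2).
have eqE (x y : 'I_#|edges 0|) : (x == y) = ((enum_val x).2 == (enum_val y).2).
  rewrite -(inj_eq enum_val_inj).
  case: (enum_val x) (enum_val y) => [u v] [u' v'].
  by rewrite -pair_eqE /pair_eq /= (tuple0 u) (tuple0 u') eqxx.
have f_inj : injective f.
  move=> x y /enum_rank_inj/(congr1 snd) /= e; apply/eqP; rewrite eqE.
  by rewrite (can_inj (@ordSK j) e).
have -> : \matrix_(x, y) ((enum_val y).2 == ordS (enum_val x).2)%:R =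
    perm_mx (perm f_inj) :> 'M[rat]_#|edges 0|.
  by apply/matrixP => x y; rewrite !mxE permE eqE enum_rankK eq_sym.
rewrite det_cyclic_perm; first by rewrite card_prod card_tuple card_ord expn0 mul1n.
have iterf i x : (enum_val (iter i f x)).2 = iter i (@ordS j) (enum_val x).2.
  by elim: i => //= i IHi; rewrite /f enum_rankK /= IHi.
apply/setP => y; rewrite inE; apply/porbitP.
(* From the layer of [r], the second summand leads to layer 0 and the first one on to the layer of
   [y]. *)
exists ((enum_val y).2 + (j - (enum_val r).2))%N.
rewrite permX (eq_iter (permE f_inj)); apply/eqP; rewrite eqE iterf -val_eqE.
rewrite val_iter_ordS addnCA subnKC ?modnDr ?modn_small // ltnW //.
Qed.

(** The matrix subtracted from the identity factors as [U *m W], where [U] drops the first letter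
    and [W] appends a random one; [det1_subC] exchanges the factors and passes to shorter words. *)
Lemma det_shift_step k (r : 'I_#|edges k.+1|) :
  \det (1%:M - \matrix_(x, y) (((wbelast (enum_val y).1, (enum_val y).2) ==
                 (wbehead (enum_val x).1, ordS (enum_val x).2))%:R / #|A|%:R)
         + \matrix_(x, y) (y == r)%:R : 'M[rat]_#|edges k.+1|) =
  \det (1%:M - \matrix_(x, y)
          (#|[set e : edges k.+1 | ((wbelast e.1, e.2) ==
               ((enum_val x).1, ordS (enum_val x).2)) &&
               (enum_val y == (wbehead e.1, e.2))]|%:R / #|A|%:R)
         + \matrix_(x, y) (y == enum_rank (wbehead (enum_val r).1, (enum_val r).2))%:R
         : 'M[rat]_#|edges k|).
Proof.
pose U : 'M[rat]_(#|edges k.+1|, #|edges k|) := \matrix_(x, z)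
  (enum_val z == (wbehead (enum_val x).1, (enum_val x).2))%:R.
(* The column of ones is absorbed in [W]: each row of [U] has a single 1, so multiplying by [U]
   reproduces that column. *)
pose W : 'M[rat]_(#|edges k|, #|edges k.+1|) := \matrix_(z, y)
  (((wbelast (enum_val y).1, (enum_val y).2) ==
   ((enum_val z).1, ordS (enum_val z).2))%:R / #|A|%:R - (y == r)%:R).
have DE m (M N : 'M[rat]_m) : 1%:M - M + N = 1%:M - (M - N).
  by rewrite opprB addrA addrAC.
rewrite !DE; transitivity (\det (1%:M - U *m W)).
  congr (\det (_ - _)); apply/matrixP => x y; rewrite !mxE.
  rewrite (bigD1 (enum_rank (wbehead (enum_val x).1, (enum_val x).2))) //=.
  rewrite !mxE enum_rankK eqxx mul1r big1 ?addr0 // => z.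
  by rewrite mxE -(inj_eq enum_val_inj) enum_rankK => /negPf->; rewrite mul0r.
rewrite det1_subC; congr (\det (_ - _)); apply/matrixP => z y; rewrite !mxE.
under eq_bigr do rewrite !mxE mulrBl mulrAC.
rewrite sumrB; congr (_ - _); last first.
  rewrite (bigD1 r) //= eqxx mul1r big1 ?addr0 => [|i /negPf->]; last by rewrite mul0r.
  by rewrite -[y == _](inj_eq enum_val_inj) enum_rankK.
rewrite -mulr_suml; congr (_ / _).
rewrite (sum_enum_val (fun e : edges k.+1 =>
  ((wbelast e.1, e.2) == ((enum_val z).1, ordS (enum_val z).2))%:R *
     (enum_val y == (wbehead e.1, e.2))%:R : rat)).
rewrite -sum1_card natr_sum [RHS]big_mkcond; apply: eq_bigr => e _.
by rewrite inE; do 2![case: eqP => _] => /=; rewrite ?mul0r ?mul1r.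
Qed.

(** Each exchange of factors removes one letter and gives a matrix of the same form, until the empty
    word is reached. *)
Lemma det_shift k (r : 'I_#|edges k.+1|) :
  \det (1%:M - \matrix_(x, y) (((wbelast (enum_val y).1, (enum_val y).2) ==
                 (wbehead (enum_val x).1, ordS (enum_val x).2))%:R / #|A|%:R)
         + \matrix_(x, y) (y == r)%:R : 'M[rat]_#|edges k.+1|) = j%:R.
Proof.
have b0 : #|A|%:R != 0 :> rat by rewrite pnatr_eq0 -lt0n.
elim: k r => [|k IHk] r; rewrite det_shift_step.
  rewrite -[RHS](det_shift0 (enum_rank (wbehead (enum_val r).1, (enum_val r).2))).
  congr (\det (_ - _ + _)); apply/matrixP => x y; rewrite !mxE.
  case: (enum_val x) (enum_val y) => [u v] [u' v'] /=.
  rewrite (tuple0 u) (tuple0 u'); have [->|/eqP ne_v] := eqVneq v' (ordS v).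
    (* Each of the [#|A|] one-letter words in the layer [ordS v] counts, which cancels the
       denominator. *)
    have tag_inj : injective (fun a => ([tuple a], ordS v) : edges 1).
      by move=> a c [].
    rewrite -[X in X / _ = _](_ : #|A|%:R = _) ?divff //; congr _%:R.
    rewrite -[LHS](card_imset predT tag_inj); apply: eq_card => -[w i].
    rewrite !inE -!pair_eqE /pair_eq /= (tuple0 (wbelast w)) (tuple0 (wbehead w)).
    apply/imsetP/idP => [[a _ /(congr1 snd) /= ->]|/andP[/andP[_ /eqP->] _]].
      by rewrite !eqxx.
    exists (thead w) => //; congr (_, _).
    by rewrite -[LHS]cons_wbehead; rewrite (tuple0 (wbehead w)); apply: val_inj.
  rewrite (_ : [set _ | _] = set0) ?cards0 ?mul0r //; apply/setP => -[w i].
  rewrite !inE -!pair_eqE /pair_eq /=.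
  apply/negP => /andP[/andP[_ /eqP ei] /andP[_ /eqP ei']].
  by rewrite -ei -ei' in ne_v.
rewrite -(IHk (enum_rank (wbehead (enum_val r).1, (enum_val r).2))).
congr (\det (_ - _ + _)); apply/matrixP => x y; rewrite !mxE; congr (_%:R / _).
case: (enum_val x) (enum_val y) => [u v] [u' v'] /=.
rewrite -[in RHS]pair_eqE /pair_eq /=.
have [eu|/eqP ne_u] := eqVneq (wbelast u') (wbehead u); last first.
  apply/eqP; rewrite cards_eq0; apply/eqP/setP => -[w i].
  rewrite !inE -!pair_eqE /pair_eq /=.
  apply/negP => /andP[/andP[/eqP eu _] /andP[/eqP eu' _]].
  by case: ne_u; rewrite -eu eu' wbelast_behead.
have [ev|ne_v] := eqVneq v' (ordS v); last first.
  apply/eqP; rewrite cards_eq0; apply/eqP/setP => -[w i].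
  rewrite !inE -!pair_eqE /pair_eq /=.
  apply/negP => /andP[/andP[_ /eqP ei] /andP[_ /eqP ei']].
  by rewrite -ei -ei' eqxx in ne_v.
rewrite (_ : [set _ | _] = [set ([tuple of thead u :: u'], v')]) ?cards1 //.
apply/setP => -[w i]; rewrite !inE -!pair_eqE /pair_eq /= -(wbelast_wbehead_eq _ eu).
rewrite ev [u' == _]eq_sym [_ == i]eq_sym.
by case: (wbelast w == u) (wbehead w == u') (i == ordS v) => [] [] [].
Qed.

End Shift.

(** * Tours *)

Lemma map_traject (T U : Type) (h : T -> U) (f : T -> T) (g : U -> U) x n :
  (forall y, h (f y) = g (h y)) -> map h (traject f x n) = traject g (h x) n.
Proof. by move=> hfg; elim: n x => //= n IHn x; rewrite IHn hfg. Qed.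

Lemma traject_next (T : eqType) (x : T) (p : seq T) :
  uniq (x :: p) -> x :: p = traject (next (x :: p)) x (size p).+1.
Proof.
move=> Up; have := cycle_next Up; rewrite [fcycle _ _]/= => /fpathP[n e].
have sz : n = (size p).+1 by rewrite -(size_rcons p x) e size_traject.
have : rcons (x :: p) x = traject (next (x :: p)) x n.+1.
  by rewrite rcons_cons e.
by rewrite sz trajectSr => /rcons_inj/(congr1 fst).
Qed.

Section Tours.

Variables (E V : finType) (src tgt : E -> V).

(** Transition systems with a single cycle encode Eulerian circuits without a marked start; [e0]
    merely serves to express that there is one orbit. *)
Definition circuit_perms (e0 : E) : {set 'S_#|E|} :=
  [set s in transitions (fun i => src (enum_val i)) (fun i => tgt (enum_val i)) |
     porbit s (enum_rank e0) == [set: 'I_#|E|]].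

Lemma iter_circuit_perm (e0 e : E) (s : 'S_#|E|) :
  s \in circuit_perms e0 ->
  porbit s (enum_rank e) = setT /\ iter #|E| s (enum_rank e) = enum_rank e.
Proof.
rewrite inE => /andP[_ /eqP s0]; have se : porbit s (enum_rank e) = setT.
  by rewrite -s0; apply/eqP; rewrite eq_porbit_mem s0 inE.
by split=> //; have := iter_porbit s (enum_rank e); rewrite se cardsT card_ord.
Qed.

(** A tour amounts to its first edge together with its successor permutation. The set [R] allows the
    first edge to be constrained, and [N] allows the length to be given by another expression than
    [#|E|]. *)
Lemma card_tours (N : nat) (R : {set E}) (e0 : E) : N = #|E| ->
  #|[set c : N.-tuple E | [&& uniq c, path.cycle (fun e f => tgt e == src f) c &
                              head e0 c \in R]]| =
  #|circuit_perms e0| * #|R|.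
Proof.
move=> hN; subst N; have E_gt0 : 0 < #|E| by apply/card_gt0P; exists e0.
have trE (T : Type) (g : T -> T) x : traject g x #|E| = x :: traject g (g x) #|E|.-1.
  by rewrite -[in LHS](prednK E_gt0).
pose f (p : 'S_#|E| * E) : #|E|.-tuple E :=
  [tuple of map enum_val (Tuple (introT eqP (size_traject p.1 (enum_rank p.2) #|E|)))].
have fE p : f p = map enum_val (traject p.1 (enum_rank p.2) #|E|) :> seq E by [].
have head_f p : head e0 (f p) = p.2.
  by rewrite fE trE /= enum_rankK.
rewrite -cardsX -(card_in_imset (f := f)); last first.
  move=> [s e] [s' e'] /setXP[/= s_c _] /setXP[/= s_c' _] eq_f.
  have ee : e = e' by have := head_f (s, e); rewrite eq_f head_f.
  subst e'; congr (_, _); apply/permP => x.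
  have [se ise] := iter_circuit_perm e s_c; have [_ ise'] := iter_circuit_perm e s_c'.
  have eq_t : traject s (enum_rank e) #|E| = traject s' (enum_rank e) #|E|.
    by apply: (inj_map enum_val_inj); move: (congr1 val eq_f).
  have eq_i i : i <= #|E| -> iter i s (enum_rank e) = iter i s' (enum_rank e).
    rewrite leq_eqVlt => /orP[/eqP->|lt_i]; first by rewrite ise ise'.
    by rewrite -(nth_traject s lt_i) eq_t nth_traject.
  have : x \in porbit s (enum_rank e) by rewrite se inE.
  rewrite porbit_traject se cardsT card_ord => /trajectP[i lt_i ->].
  by rewrite -iterS eq_i // iterS eq_i // ltnW.
apply: eq_card => c; rewrite inE; apply/and3P/imsetP => [[Uc cc Rc]|].
  have memc e : e \in c.
    suff -> : c =i E by [].
    by apply/subset_cardP; [rewrite (card_uniqP Uc) size_tuple | apply/subsetP].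
  (* As [c] is duplicate-free and visits every edge, [next c] is a permutation of all edges, with
     inverse [prev c]. *)
  have n_inj : injective (fun i : 'I_#|E| => enum_rank (next c (enum_val i))).
    move=> i i' e; have {}e := enum_rank_inj e.
    by apply: enum_val_inj; rewrite -[LHS](prev_next Uc) e prev_next.
  have ct : c = traject (next c) (head e0 c) #|E| :> seq E.
    have := size_tuple c; move: Uc; case: (tval c) => [_ sz|x p Up sz].
      by rewrite -sz in E_gt0.
    by rewrite /= -sz; apply: traject_next.
  have fc : f (perm n_inj, head e0 c) = c.
    apply: val_inj; rewrite [LHS]fE /= (map_traject (g := next c)).
      by rewrite enum_rankK.
    by move=> y; rewrite permE enum_rankK.
  exists (perm n_inj, head e0 c); last by [].
  rewrite inE /= Rc andbT inE; apply/andP; split.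
    apply/transitionsP => i; rewrite permE enum_rankK; apply/esym/eqP.
    exact: (next_cycle cc).
  suff h : porbit (perm n_inj) (enum_rank (head e0 c)) = setT.
    by rewrite -h eq_porbit_mem h inE.
  apply/setP => i; rewrite inE; have := memc (enum_val i).
  rewrite -{1}fc [_ \in _](mem_map enum_val_inj) => /trajectP[l _ ->].
  by rewrite -permX mem_porbit.
case=> -[s e] /setXP[/= s_c Re] ->; rewrite head_f.
have [se ise] := iter_circuit_perm e s_c; split=> //.
  rewrite (map_inj_uniq enum_val_inj).
  by have := uniq_traject_porbit s (enum_rank e); rewrite se cardsT card_ord.
rewrite fE /=; move: s_c; rewrite inE => /andP[/transitionsP s_t _].
rewrite trE /= -map_rcons.
have -> : rcons (traject s (s (enum_rank e)) #|E|.-1) (enum_rank e) =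
    traject s (s (enum_rank e)) #|E|.-1.+1.
  by rewrite trajectSr -iterSr (prednK E_gt0) ise.
rewrite path_map.
apply: (@sub_path _ (frel s)); last exact: fpath_traject.
by move=> x y /= /eqP<-; rewrite s_t.
Qed.

End Tours.

(** * Rotation classes *)

Lemma nth_rot (T : Type) (x : T) (s : seq T) i t :
  i <= size s -> t < size s -> nth x (rot i s) t = nth x s ((i + t) %% size s).
Proof.
move=> le_i lt_t; rewrite /rot nth_cat size_drop nth_drop ltn_subRL.
case: ltnP => [lt_it|le_it]; first by rewrite modn_small.
have e : t - (size s - i) = i + t - size s by rewrite subnBA // addnC.
have lt_e : i + t - size s < i by rewrite ltn_subLR // addnC ltn_add2r.
rewrite e nth_take //; congr nth.
rewrite -[in RHS](subnKC le_it) modnDl modn_small //.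
exact: leq_trans lt_e le_i.
Qed.

(** Burnside's lemma for the cyclic group of order [N] rotating the words that satisfy [P]; the
    necklaces are its orbits. *)
Lemma card_necklaces_pred (B : finType) (N : nat) (P : pred (N.-tuple B)) :
  0 < N -> (forall i (s : N.-tuple B), i < N -> P [tuple of rot i s] = P s) ->
  #|[set X in necklaces B N | [forall s in X, P s]]| * N =
  \sum_(r < N) #|[set s : N.-tuple B | P s && (rot r s == s :> seq B)]|.
Proof.
case: N P => // N P _ P_rot.
pose to (s : N.+1.-tuple B) (i : 'I_N.+1) := [tuple of rot i s].
have to1 : to^~ 1%g =1 id by move=> s; apply: val_inj; rewrite /= rot0.
have toM s : act_morph to s.
  move=> i i'; apply: val_inj => /=; case: s => -[//|b0 s] /= /eqP sz_s.
  have {}sz_s : size (b0 :: s) = N.+1 := sz_s.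
  apply: (@eq_from_nth _ b0); rewrite ?size_rot // => t lt_t.
  have [lt_i lt_i'] : i < size (b0 :: s) /\ i' < size (b0 :: s) by rewrite sz_s !ltn_ord.
  have lt_m : (i + i') %% N.+1 < size (b0 :: s) by rewrite sz_s ltn_pmod.
  rewrite !nth_rot ?size_rot ?ltn_pmod // 1?ltnW // !sz_s.
  by rewrite modnDml modnDmr addnA.
pose act := TotalAction to1 toM.
have equivE (s t : N.+1.-tuple B) : rotation_equiv s t = (t \in orbit act setT s).
  apply/existsP/orbitP => [[i /eqP e]|[i _ <-]]; last first.
    by exists (widen_ord (leqnSn _) i).
  have [lt_i|ge_i] := ltnP i N.+1.
    by exists (Ordinal lt_i) => //; apply: val_inj; exact: e.
  (* [rotation_equiv] also admits the rotation by the full length, which acts as the identity. *)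
  exists 1%g => //; rewrite [LHS]to1; apply: val_inj; rewrite /= -e.
  by rewrite rot_oversize // size_tuple.
have classE (s : N.+1.-tuple B) :
    [set t in [set: N.+1.-tuple B] | rotation_equiv s t] = orbit act setT s.
  by apply/setP => t; rewrite inE in_setT equivE.
have acts : [acts [set: 'I_N.+1], on [set s | P s] | act].
  by apply/actsP => i _ s; rewrite !inE [LHS]P_rot.
have := Frobenius_Cauchy acts; rewrite cardsT card_ord => e.
transitivity (#|[set orbit act [set: 'I_N.+1] s | s in [set s | P s]]| * N.+1).
  congr (_ * _); apply: eq_card => X; rewrite inE.
  apply/andP/imsetP => [[/imsetP[s _ ->] /forall_inP Ps]|[s]].
    exists s; last exact: classE.
    by rewrite inE Ps // classE orbit_refl.
  rewrite inE => Ps ->; split; first by apply/imsetP; exists s; rewrite ?classE.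
  apply/forall_inP => t /orbitP[i _ <-]; by rewrite [P _]P_rot.
rewrite -e; apply: eq_big => [i|i _]; first by rewrite inE.
apply: eq_card => s; rewrite inE in_setI inE; congr (_ && _).
by apply/afix1P/eqP => [/(congr1 val)|e'] //; apply: val_inj.
Qed.

(** * Eulerian circuits as single-cycle transition systems *)

Section Circuits.

Variable G : multidigraph.

Lemma eulerian_tourE (c : #|edge G|.-tuple (edge G)) :
  eulerian_tour c =
  uniq c && path.cycle (fun e f => target e == source f) c.
Proof.
congr (_ && _); apply/forallP/idP => [c1|Uc e].
  apply: count_mem_uniq => e; rewrite (eqP (c1 e)).
  by have := c1 e; case: (boolP (e \in c)) => // /count_memPn->.
rewrite (count_uniq_mem _ Uc); suff -> : c =i edge G by [].
by apply/subset_cardP; [rewrite (card_uniqP Uc) size_tuple | apply/subsetP].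
Qed.

(** A duplicate-free sequence is fixed only by the trivial rotation, so each circuit yields
    [#|edge G|] tours, one for each first edge. *)
Lemma card_eulerian_circuits (e0 : edge G) :
  #|eulerian_circuits G| = #|circuit_perms (@source G) (@target G) e0|.
Proof.
have E_gt0 : 0 < #|edge G| by apply/card_gt0P; exists e0.
apply/eqP; rewrite -(eqn_pmul2r E_gt0) card_necklaces_pred //; last first.
  by move=> i c _; rewrite !eulerian_tourE rot_uniq rot_cycle.
rewrite -[X in _ * X]cardsT -(card_tours _ _ [set: edge G] e0 erefl).
rewrite (bigD1 (Ordinal E_gt0)) //= big1 ?addn0; last first.
  move=> r ne_r0; apply/eqP; rewrite cards_eq0; apply/eqP/setP => c; rewrite !inE.
  rewrite eulerian_tourE; apply/negP => /andP[/andP[Uc _] /eqP rc].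
  have := nth_rot e0 (s := c) (i := r) (t := 0).
  rewrite size_tuple => /(_ (ltnW (ltn_ord r)) E_gt0).
  rewrite rc addn0 modn_small // => /eqP; rewrite nth_uniq ?size_tuple //.
  by rewrite eq_sym; apply/negP.
apply/eqP; apply: eq_card => c; rewrite !inE rot0 eqxx andbT eulerian_tourE.
by rewrite andbT.
Qed.

End Circuits.

(** * Eulerian circuits of the astute graph *)

Section Astute.

Variables (A : finType) (k j : nat).
Hypotheses (A_gt0 : 0 < #|A|) (j_gt0 : 0 < j).

Notation G := (astute_graph A k j).

(** In [card_cyclic_transitions] the determinant is [j] by [det_shift], while the number of edges is
    [#|A| ^ k.+1 * j]; cancelling [j] leaves the power of [#|A|]. *)
Lemma card_astute_circuit_perms (e0 : edge G) :
  #|circuit_perms (@source G) (@target G) e0| * #|A| ^ k.+1 =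
  #|A|`! ^ (j * #|A| ^ k).
Proof.
(* Edges entering a node are labelled by the letter put in front of its word, edges leaving it by
   the letter appended. *)
pose inn (x : node G) (a : A) : 'I_#|edge G| :=
  enum_rank ([tuple of a :: x.1], ord_pred x.2).
pose out (x : node G) (a : A) : 'I_#|edge G| :=
  enum_rank ([tuple of rcons x.1 a], x.2).
pose lin (i : 'I_#|edge G|) : A := thead (enum_val i).1.
pose lout (i : 'I_#|edge G|) : A := wlast (enum_val i).1.
pose src (i : 'I_#|edge G|) := source (enum_val i).
pose tgt (i : 'I_#|edge G|) := target (enum_val i).
have tgt_inn x a : tgt (inn x a) = x.
  rewrite /tgt enum_rankK; case: x => u v; rewrite /= ord_predK.
  by congr (_, _); apply: wbehead_cons.
have lin_inn x a : lin (inn x a) = a by rewrite /lin enum_rankK theadE.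
have inn_lin i : inn (tgt i) (lin i) = i.
  rewrite -[RHS]enum_valK /inn /tgt /lin; congr enum_rank.
  case: (enum_val i) => w v; rewrite /= ordSK; congr (_, _).
  exact: cons_wbehead.
have src_out x a : src (out x a) = x.
  rewrite /src enum_rankK; case: x => u v /=.
  by congr (_, _); apply: wbelast_rcons.
have lout_out x a : lout (out x a) = a by rewrite /lout enum_rankK wlast_rcons.
have out_lout i : out (src i) (lout i) = i.
  rewrite -[RHS]enum_valK /out /src /lout; congr enum_rank.
  case: (enum_val i) => w v; rewrite /=; congr (_, _).
  exact: rcons_wbelast.
have cardE : #|edge G| = #|A| ^ k.+1 * j by rewrite card_prod card_tuple card_ord.
have cardV : #|node G| = #|A| ^ k * j by rewrite card_prod card_tuple card_ord.
have := card_cyclic_transitions rat tgt A_gt0 (card_out_fiber src_out lout_out out_lout)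
  (enum_rank e0).
rewrite (card_transitions tgt_inn lin_inn inn_lin src_out lout_out out_lout).
rewrite [X in (_ = _ * X)%R](det_shift A_gt0) [X in (_ * X%:R = _)%R]cardE -!natrM => /eqP.
rewrite eqr_nat mulnA eqn_pmul2r // => /eqP.
by rewrite cardV [_ * j]mulnC => <-.
Qed.

Lemma card_astute_circuits :
  #|eulerian_circuits (astute_graph A k j)| * #|A| ^ k.+1 = #|A|`! ^ (j * #|A| ^ k).
Proof.
case/card_gt0P: (A_gt0) => a _.
by rewrite (card_eulerian_circuits (([tuple of nseq k.+1 a], Ordinal j_gt0) : edge G))
  card_astute_circuit_perms.
Qed.

End Astute.

(** * Perfect words *)

Lemma cycle_nthP (T : Type) (e : rel T) (x0 : T) (s : seq T) :
  reflect (forall i, i < size s -> e (nth x0 s i) (nth x0 s (i.+1 %% size s)))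
          (path.cycle e s).
Proof.
case: s => [|x p]; first by apply: (iffP idP).
have nthE i : i < (size p).+1 ->
    nth x0 (x :: rcons p x) i = nth x0 (x :: p) i /\
    nth x0 (rcons p x) i = nth x0 (x :: p) (i.+1 %% (size p).+1).
  rewrite ltnS leq_eqVlt => /orP[/eqP->|lt_i].
    by rewrite -rcons_cons !nth_rcons /= ltnSn ltnn eqxx modnn.
  by rewrite -rcons_cons !nth_rcons /= ltnS (ltnW lt_i) lt_i modn_small.
apply: (iffP (pathP x0)) => H i; rewrite ?size_rcons => lt_i; have [e1 e2] := nthE i lt_i.
  by rewrite -e1 -e2; apply: H; rewrite size_rcons.
by rewrite e1 e2; apply: H.
Qed.

Section PerfectWords.

Variables (A : finType) (a0 : A).

(** Positions are arbitrary naturals, reduced only when a letter is read, so that they can be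
    shifted freely. *)
Definition window k N (s : N.-tuple A) (i : nat) : k.-tuple A :=
  [tuple nth a0 s ((i + t) %% N) | t < k].

Lemma eq_windowP k N M (s : N.-tuple A) (t : M.-tuple A) i i' :
  (forall l, nth a0 s ((i + l) %% N) = nth a0 t ((i' + l) %% M)) ->
  window k s i = window k t i'.
Proof. by move=> e; apply: eq_from_tnth => l; rewrite !tnth_mktuple. Qed.

Lemma window_mod k N (s : N.-tuple A) i : window k s (i %% N) = window k s i.
Proof. by apply: eq_windowP => l; rewrite modnDml. Qed.

Lemma occurs_atE k N (u : k.-tuple A) (s : N.-tuple A) (i : 'I_N) :
  occurs_at u s i = (window k s i == u).
Proof.
have N_gt0 : 0 < N := leq_ltn_trans (leq0n i) (ltn_ord i).
have sE t : onth s ((i + t) %% N) = Some (nth a0 s ((i + t) %% N)).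
  rewrite -(tnth_nth a0 s (Ordinal (ltn_pmod (i + t) N_gt0))).
  exact/(tnth_onth _ s (Ordinal (ltn_pmod (i + t) N_gt0))).
apply/'forall_eqP/eqP => [H|<- t].
  apply: eq_from_tnth => t; rewrite tnth_mktuple.
  by apply/esym/(tnth_onth _ u t); rewrite -H sE.
rewrite sE; apply/esym/(tnth_onth _ (window k s i) t).
by rewrite tnth_mktuple.
Qed.

(** Perfection says that a position is determined by its window and its residue modulo [n]. There
    are as many such pairs as positions, so injectivity yields bijectivity, hence [n] occurrences of
    each word. *)
Lemma perfect_wordP k n (s : (n * #|A| ^ k).-tuple A) : 0 < n ->
  reflect (forall i i', window k s i = window k s i' -> i = i' %[mod n] ->
             i = i' %[mod n * #|A| ^ k])
          (perfect_word k n s).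
Proof.
move=> n_gt0; set N := n * _ in s *.
have N_gt0 : 0 < N.
  by rewrite muln_gt0 n_gt0 expn_gt0; apply/orP; left; apply/card_gt0P; exists a0.
have dvN : n %| N by rewrite dvdn_mulr.
apply: (iffP forallP) => [Ps i i' ew en|Ps u].
  have /andP[_ /forall_inP H] := Ps (window k s i).
  pose o l : 'I_N := Ordinal (ltn_pmod l N_gt0).
  have occ l : window k s l = window k s i -> o l \in occurrences (window k s i) s.
    by move=> e; rewrite inE occurs_atE /= window_mod e.
  have /forall_inP/(_ (o i')) := H (o i) (occ i erefl).
  move=> /(_ (occ i' (esym ew))); rewrite /= !modn_dvdm // en eqxx implybF negbK.
  by move/eqP/(congr1 val).
pose f (i : 'I_N) : k.-tuple A * 'I_n := (window k s i, Ordinal (ltn_pmod i n_gt0)).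
have f_inj : injective f.
  move=> i i' e; apply: val_inj.
  have := Ps i i' (congr1 fst e) (congr1 (fun x => val x.2) e).
  by rewrite !modn_small.
have [g fK gK] : bijective f.
  apply: (inj_card_bij f_inj).
  by rewrite card_prod card_tuple !card_ord mulnC.
have h_inj : injective (fun v : 'I_n => g (u, v)).
  by move=> v v' /(can_inj gK) [].
apply/andP; split.
  rewrite -[X in _ == X]card_ord -(card_imset predT h_inj).
  apply/eqP/eq_card => i; rewrite inE occurs_atE.
  apply/eqP/imsetP => [wi|[v _ ->]]; last by rewrite -[RHS](congr1 fst (gK (u, v))).
  by exists (f i).2 => //; rewrite -wi -[LHS]fK.
apply/forall_inP => i; rewrite inE occurs_atE => /eqP wi.
apply/forall_inP => i'; rewrite inE occurs_atE => /eqP wi'.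
apply/implyP; apply: contraNneq => e; apply/eqP/f_inj.
by rewrite /f wi wi'; congr (_, _); apply: val_inj.
Qed.

End PerfectWords.

(** * Perfect words as tours of the astute graph *)

Section PerfectTours.

Variables (A : finType) (a0 : A) (k n : nat).
Hypothesis n_gt0 : 0 < n.

Notation N := (n * #|A| ^ k.+1).
Notation G := (astute_graph A k n).

Let A_gt0 : 0 < #|A|. Proof. by apply/card_gt0P; exists a0. Qed.

Let N_gt0 : 0 < N. Proof. by rewrite muln_gt0 n_gt0 expn_gt0 A_gt0. Qed.

(** Reading the windows of a perfect word, each with its position modulo [n], gives a tour starting
    in layer 0, and every such tour arises once. *)
Lemma card_perfect_words :
  #|[set s : N.-tuple A | perfect_word k.+1 n s]| = #|A|`! ^ (n * #|A| ^ k).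
Proof.
pose lay i : 'I_n := Ordinal (ltn_pmod i n_gt0).
pose e0 : edge G := ([tuple of nseq k.+1 a0], lay 0).
(* The [#|A| ^ k.+1] possible first edges in layer 0 supply the factor missing from the count of
   circuits. *)
pose R : {set edge G} := [set e | e.2 == lay 0].
have cardR : #|R| = #|A| ^ k.+1.
  rewrite -(card_tuple k.+1 A) -(card_imset predT (f := fun w => (w, lay 0) : edge G)).
    apply: eq_card => -[w v]; rewrite inE /=.
    by apply/eqP/imsetP => [->|[w' _ [_ ->]]] //; exists w.
  by move=> w w' [].
rewrite -(card_astute_circuit_perms A_gt0 n_gt0 e0) -[X in _ = _ * X]cardR.
rewrite -(card_tours _ _ _ _ (N := N)); last first.
  by rewrite card_prod card_tuple card_ord mulnC.
pose f (s : N.-tuple A) : N.-tuple (edge G) :=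
  [tuple (window a0 k.+1 s i, lay i) | i < N].
have nth_f s i : i < N -> nth e0 (f s) i = (window a0 k.+1 s i, lay i).
  by move=> lt_i; rewrite -[i]/(val (Ordinal lt_i)) -tnth_nth tnth_mktuple.
have thead_w (s : N.-tuple A) i : i < N -> thead (window a0 k.+1 s i) = nth a0 s i.
  by move=> lt_i; rewrite /thead tnth_mktuple /= addn0 modn_small.
have f_inj : injective f.
  move=> s s' e; apply: (@val_inj _ _ _); apply: (@eq_from_nth _ a0).
    by rewrite !size_tuple.
  rewrite size_tuple => i lt_i; rewrite -!thead_w //.
  have := congr1 (fun c : N.-tuple (edge G) => (nth e0 c i).1) e.
  by rewrite /= !nth_f //= => ->.
have modNn i : (i %% N) %% n = i %% n by rewrite modn_dvdm // dvdn_mulr.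
have uniq_f s : uniq (f s) = perfect_word k.+1 n s.
  apply/(uniqP e0)/(perfect_wordP a0 s n_gt0) => [Us i i' ew en|Ps i i'].
    apply: Us; rewrite ?inE ?size_tuple ?ltn_pmod // !nth_f ?ltn_pmod //.
    by rewrite !window_mod ew; congr (_, _); apply: val_inj; rewrite /= !modNn.
  rewrite !inE size_tuple => lt_i lt_i'; rewrite !nth_f // => e.
  have := Ps i i' (congr1 fst e) (congr1 (fun x : edge G => val x.2) e).
  by rewrite !modn_small.
transitivity #|f @: [set s | perfect_word k.+1 n s]|; first by rewrite card_imset.
apply: eq_card => c; rewrite [RHS]inE.
apply/imsetP/and3P => [[s]|[Uc /(cycle_nthP _ e0) cc Rc]].
  rewrite inE => Ps ->; split; first by rewrite uniq_f.
    apply/(cycle_nthP _ e0); rewrite size_tuple => i lt_i.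
    rewrite !nth_f ?ltn_pmod //; apply/eqP; congr (_, _).
      apply: eq_from_tnth => t; rewrite !tnth_mktuple lift0 /=.
      by rewrite modnDml addSnnS.
    by apply: val_inj; rewrite /= modNn -addn1 modnDml addn1.
  by rewrite -nth0 nth_f // inE.
rewrite size_tuple in cc; rewrite inE -nth0 in Rc.
have lay_c i : i < N -> (nth e0 c i).2 = lay i.
  elim: i => [_|i IHi lt_i]; first exact/eqP.
  have := cc i (ltnW lt_i); rewrite modn_small // => /eqP/(congr1 snd) /= <-.
  by rewrite IHi ?(ltnW lt_i) //; apply: val_inj; rewrite /= -addn1 modnDml addn1.
pose L i := thead (nth e0 c (i %% N)).1.
(* Consecutive edges overlap, so moving one edge ahead lowers the index of a letter by one, until it
   is the first letter recorded by [L]. *)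
have c_L t (lt_t : t < k.+1) i :
    i < N -> tnth (nth e0 c i).1 (Ordinal lt_t) = L (i + t).
  elim: t lt_t i => [|t IHt] lt_t i lt_i.
    by rewrite addn0 /L modn_small //; congr tnth; apply: val_inj.
  have /eqP/(congr1 fst)/= e := cc i lt_i.
  have lt_tk : t < k by [].
  transitivity (tnth (wbehead (nth e0 c i).1) (Ordinal lt_tk)).
    by rewrite tnth_mktuple; congr tnth; apply: val_inj.
  rewrite [wbehead _]e tnth_mktuple.
  rewrite (_ : widen_ord _ _ = Ordinal (ltnW lt_t)); last exact: val_inj.
  by rewrite IHt ?ltn_pmod // /L modnDml addSnnS.
pose s : N.-tuple A := [tuple L i | i < N].
have nth_s i : nth a0 s (i %% N) = L i.
  have lt_i : i %% N < N by rewrite ltn_pmod.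
  rewrite -[i %% N]/(val (Ordinal lt_i)) -tnth_nth tnth_mktuple /=.
  by rewrite /L modn_mod.
have fs : f s = c.
  apply: val_inj; apply: (@eq_from_nth _ e0); first by rewrite !size_tuple.
  rewrite size_tuple => i lt_i; rewrite nth_f // [RHS]surjective_pairing.
  rewrite lay_c //; congr (_, _); apply: eq_from_tnth => -[t lt_t].
  by rewrite tnth_mktuple nth_s c_L.
by exists s; rewrite ?inE // -uniq_f fs.
Qed.

End PerfectTours.

(** By Bezout, steps of length [g] reach every residue modulo [n] in the same class modulo
    [gcdn n g]. *)
Lemma modn_gcd_shift n g i i' : 0 < n -> 0 < g -> i = i' %[mod gcdn n g] ->
  exists x, i' + x * g = i %[mod n].
Proof.
move=> n_gt0 g_gt0 e; case: (egcdnP n g_gt0) => km kn; rewrite gcdnC => ekm _.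
(* The term [n.-1 * i'] stands for the opposite of [i'] modulo [n]. *)
have /dvdnP[c ec] : gcdn n g %| i + n.-1 * i'.
  apply/eqP; rewrite -modnDml e modnDml -mulSn prednK //.
  exact/eqP/dvdn_mulr/dvdn_gcdl.
exists (c * km); rewrite -mulnA ekm mulnDr addnCA mulnA modnMDl -ec addnCA.
by rewrite -mulSn prednK // addnC mulnC modnMDl.
Qed.

(** * Perfect words fixed by a rotation *)

Section Periodic.

Variables (A : finType) (a0 : A).

Lemma nth_rot_mod N (s : N.-tuple A) r l : 0 < N -> r < N ->
  nth a0 (rot r s) (l %% N) = nth a0 s ((l + r) %% N).
Proof.
move=> N_gt0 lt_r; rewrite nth_rot size_tuple ?ltn_pmod //; last exact: ltnW.
by rewrite modnDmr addnC.
Qed.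

Lemma perfect_word_rot k n (s : (n * #|A| ^ k).-tuple A) r : 0 < n ->
  r < n * #|A| ^ k -> perfect_word k n [tuple of rot r s] = perfect_word k n s.
Proof.
move=> n_gt0 lt_r; have N_gt0 := leq_ltn_trans (leq0n r) lt_r.
have wE i : window a0 k [tuple of rot r s] i = window a0 k s (i + r).
  by apply: eq_windowP => l; rewrite /= nth_rot_mod // addnAC.
apply/(perfect_wordP a0 _ n_gt0)/(perfect_wordP a0 _ n_gt0) => Ps i i' ew en.
  have cancel_r l : l + (n * #|A| ^ k - r) + r = l + n * #|A| ^ k.
    by rewrite -addnA subnK // ltnW.
  have wN l : window a0 k s (l + n * #|A| ^ k) = window a0 k s l.
    by rewrite -window_mod modnDr window_mod.
  have := Ps (i + (n * #|A| ^ k - r)) (i' + (n * #|A| ^ k - r)).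
  rewrite !wE !cancel_r !wN.
  move=> /(_ ew); rewrite -(modnDml i) -(modnDml i') en => /(_ erefl)/eqP.
  by rewrite eqn_modDr => /eqP.
move: (Ps (i + r) (i' + r)); rewrite -!wE => /(_ ew).
by rewrite -(modnDml i) -(modnDml i') en => /(_ erefl)/eqP; rewrite eqn_modDr => /eqP.
Qed.

(** By Bezout, the multiples of [r] and of [gcdn r N] agree modulo [N]. *)
Lemma rot_fixedP N (s : N.-tuple A) r : 0 < N -> r < N ->
  reflect (forall i, nth a0 s ((i + gcdn r N) %% N) = nth a0 s (i %% N))
          (rot r s == s :> seq A).
Proof.
move=> N_gt0 lt_r; apply: (iffP eqP) => [rs|per].
  have perr c i : nth a0 s ((i + c * r) %% N) = nth a0 s (i %% N).
    elim: c i => [|c IHc] i; first by rewrite addn0.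
    by rewrite mulSn addnA IHc -[in RHS]rs nth_rot_mod.
  move=> i; case: (posnP r) => [->|r_gt0]; first by rewrite gcd0n modnDr.
  case: (egcdnP N r_gt0) => km kn e _.
  by rewrite -[RHS](perr km) e addnCA modnMDl.
have perg c i : nth a0 s ((i + c * gcdn r N) %% N) = nth a0 s (i %% N).
  elim: c i => [|c IHc] i; first by rewrite addn0.
  by rewrite mulSn addnA IHc per.
apply: (@eq_from_nth _ a0); rewrite size_rot // size_tuple => i lt_i.
rewrite -[in LHS](modn_small lt_i) nth_rot_mod //.
by rewrite -(divnK (dvdn_gcdl r N)) perg modn_small.
Qed.

Lemma perfect_word_lcm k n (s : (n * #|A| ^ k).-tuple A) g : 0 < n ->
  g %| n * #|A| ^ k -> perfect_word k n s ->
  (forall i, nth a0 s ((i + g) %% (n * #|A| ^ k)) = nth a0 s (i %% (n * #|A| ^ k))) ->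
  lcmn n g = n * #|A| ^ k.
Proof.
move=> n_gt0 dv_g /(perfect_wordP a0 _ n_gt0) Ps per.
set N := n * _ in s dv_g Ps per *.
have perg c i : nth a0 s ((i + c * g) %% N) = nth a0 s (i %% N).
  elim: c i => [|c IHc] i; first by rewrite addn0.
  by rewrite mulSn addnA IHc per.
apply/eqP; rewrite eqn_dvd dvdn_lcm dv_g dvdn_mulr //=.
suff : lcmn n g = 0 %[mod N] by rewrite mod0n => /eqP.
apply: Ps; last by apply/eqP; rewrite mod0n; apply: dvdn_lcml.
apply: eq_windowP => l; rewrite add0n addnC -(divnK (dvdn_lcmr n g)).
exact: perg.
Qed.

(** The bijection [h] repeats a word of length [g = gcdn n g * #|A| ^ k]. Since [lcmn n g] is the
    full length, a position is determined by its residues modulo [n] and modulo [g]. *)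
Lemma card_periodic_perfect_words k n g : 0 < n -> 0 < g ->
  lcmn n g = n * #|A| ^ k ->
  #|[set s : (n * #|A| ^ k).-tuple A | perfect_word k n s &&
      [forall i : 'I_(n * #|A| ^ k), nth a0 s ((i + g) %% (n * #|A| ^ k)) == nth a0 s i]]|
  = #|[set t : (gcdn n g * #|A| ^ k).-tuple A | perfect_word k (gcdn n g) t]|.
Proof.
move=> n_gt0 g_gt0 lcmN; set N := n * _ in lcmN *; set j := gcdn n g.
have j_gt0 : 0 < j by rewrite gcdn_gt0 n_gt0.
have gE : g = j * #|A| ^ k.
  apply/eqP; rewrite -(eqn_pmul2l n_gt0) -muln_lcm_gcd lcmN -/j.
  by rewrite /N mulnAC mulnA.
have N_gt0 : 0 < N by rewrite -lcmN lcmn_gt0 n_gt0.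
have dv_gN : g %| N by rewrite -lcmN dvdn_lcmr.
set M := j * _ in gE *.
pose h (t : M.-tuple A) : N.-tuple A := [tuple nth a0 t (i %% M) | i < N].
have nth_h t i : nth a0 (h t) (i %% N) = nth a0 t (i %% M).
  have lt_i : i %% N < N by rewrite ltn_pmod.
  rewrite -[i %% N]/(val (Ordinal lt_i)) -tnth_nth tnth_mktuple /=.
  by rewrite modn_dvdm // -gE.
have le_MN : M <= N by rewrite -gE dvdn_leq.
have h_inj : injective h.
  move=> t t' e; apply: val_inj; apply: (@eq_from_nth _ a0); first by rewrite !size_tuple.
  rewrite size_tuple => i lt_i; have := nth_h t i; rewrite e nth_h.
  by rewrite !modn_small.
rewrite -(card_imset _ h_inj); apply: eq_card => s; rewrite inE.
have wE t i : window a0 k (h t) i = window a0 k t i.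
  by apply: eq_windowP => l; rewrite nth_h.
have perf_h t : perfect_word k n (h t) = perfect_word k j t.
  apply/(perfect_wordP a0 _ n_gt0)/(perfect_wordP a0 _ j_gt0) => Pt i i' ew en.
    (* Adding a multiple of the period [g] to [i'] keeps its window and corrects its residue modulo
       [n]. *)
    have [x ex] := modn_gcd_shift n_gt0 g_gt0 en.
    have /Pt /(_ ex) : window a0 k (h t) (i' + x * g) = window a0 k (h t) i.
      rewrite !wE ew; apply: eq_windowP => l.
      by rewrite addnAC gE addnC modnMDl.
    by move/(congr1 (modn^~ g)); rewrite !modn_dvdm // addnC modnMDl gE => ->.
  (* Conversely, congruence modulo [n] implies congruence modulo [j], so perfection of [t] gives
     congruence modulo [g], and both together give it modulo the lcm. *)
  rewrite -/N -lcmN; move: en; wlog le_i : i i' ew / i' <= i.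
    by move=> W en; case/orP: (leq_total i' i) => le; [|apply: esym]; apply: W.
  move/eqP; rewrite eqn_mod_dvd // => dv_n; apply/eqP; rewrite eqn_mod_dvd //.
  rewrite dvdn_lcm dv_n /= gE -eqn_mod_dvd //; apply/eqP; apply: Pt; first by rewrite -!wE.
  by apply/eqP; rewrite eqn_mod_dvd //; apply: dvdn_trans (dvdn_gcdl _ _) dv_n.
apply/andP/imsetP => [[Ps /forallP per]|[t]]; last first.
  rewrite inE -perf_h => Pt ->; split=> //; apply/forallP => i.
  by rewrite -[in X in _ == X](modn_small (ltn_ord i)) !nth_h gE modnDr.
have {}per c i : nth a0 s ((i + c * g) %% N) = nth a0 s (i %% N).
  elim: c i => [|c IHc] i; first by rewrite addn0.
  rewrite mulSn addnA IHc; have lt_i : i %% N < N by rewrite ltn_pmod.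
  by rewrite -(eqP (per (Ordinal lt_i))) /= modnDml.
have hs : h [tuple nth a0 s i | i < M] = s.
  apply: val_inj; apply: (@eq_from_nth _ a0); first by rewrite !size_tuple.
  rewrite size_tuple => i lt_i; rewrite -(modn_small lt_i) nth_h.
  have lt_M : i %% M < M by rewrite ltn_pmod // -gE.
  rewrite -[i %% M]/(val (Ordinal lt_M)) -tnth_nth tnth_mktuple /=.
  have := per (i %/ g) (i %% g); rewrite addnC -divn_eq gE => ->.
  by rewrite [(_ %% _) %% N]modn_small // (leq_trans lt_M).
by exists [tuple nth a0 s i | i < M]; rewrite ?inE // -perf_h hs.
Qed.

End Periodic.

(** * Counting necklaces *)

(** The rotations counted are the [l * g] with [l] coprime to [N %/ g]. *)
Lemma card_gcdn_eq N g : 0 < N -> g %| N ->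
  #|[set r : 'I_N | gcdn r N == g]| = totient (N %/ g).
Proof.
move=> N_gt0 /dvdnP[M eN]; subst N.
have [M_gt0 g_gt0] : 0 < M /\ 0 < g by apply/andP; rewrite -muln_gt0.
rewrite mulnK // totient_count_coprime big_mkord -sum1_card.
have lt_f (r : 'I_M) : r * g < M * g by rewrite ltn_pmul2r.
pose f (r : 'I_M) : 'I_(M * g) := Ordinal (lt_f r).
have f_inj : injective f.
  by move=> r r' /(congr1 val) /= /eqP; rewrite eqn_pmul2r // => /eqP/val_inj.
rewrite (eq_bigr (fun r : 'I_M => if coprime M r then 1 else 0)); last first.
  by move=> r _; case: coprime.
rewrite -big_mkcond !sum1_card -(card_imset _ f_inj).
apply: eq_card => r; rewrite inE; apply/eqP/imsetP => [er|[l]].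
  have /dvdnP[l el] : g %| r by have := dvdn_gcdl r (M * g); rewrite er.
  have lt_l : l < M by have := ltn_ord r; rewrite el ltn_pmul2r.
  exists (Ordinal lt_l); last exact: val_inj.
  change (gcdn M l == 1).
  by rewrite gcdnC -(eqn_pmul2r g_gt0) muln_gcdl -el er mul1n.
rewrite unfold_in => /eqP cl ->.
by rewrite /= -muln_gcdl gcdnC cl mul1n.
Qed.

(** [d_part b n] carries the full power in [n] of each prime of [b], so [j] contains it exactly when
    the cofactor retains none of these primes. *)
Lemma d_part_dvd b n j : 0 < b -> 0 < n -> j %| n ->
  (d_part b n %| j) = coprime b (n %/ j).
Proof.
move=> b_gt0 n_gt0 /dvdnP[q eq_n]; subst n.
have [q_gt0 j_gt0] : 0 < q /\ 0 < j by apply/andP; rewrite -muln_gt0.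
rewrite mulnK //; apply/idP/idP => [dv|co].
  rewrite coprime_has_primes //; apply/hasPn => p; rewrite !mem_primes.
  case/and3P=> pr_p _ pq; apply/negP => /and3P[_ _ pb].
  have : p ^ logn p (q * j) %| j.
    apply: dvdn_trans dv; rewrite /d_part (big_rem p) ?dvdn_mulr //=.
    by rewrite mem_primes pr_p b_gt0.
  rewrite pfactor_dvdn // lognM // -{2}[logn p j]add0n leq_add2r leqNgt.
  by rewrite logn_gt0 mem_primes pr_p q_gt0 pq.
(* The prime powers are pairwise coprime, so they are treated one at a time: each divides [q * j]
   and is coprime to [q]. *)
rewrite /d_part; have : all (fun p => prime p && (p %| b)) (primes b).
  by apply/allP => p; rewrite mem_primes => /and3P[-> _ ->].
have := primes_uniq b; elim: (primes b) => [|p l IHl] /=.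
  by rewrite big_nil dvd1n.
case/andP=> p_l Ul /andP[/andP[pr_p pb] al]; rewrite big_cons Gauss_dvd.
  rewrite (IHl Ul al) andbT; have : p ^ logn p (q * j) %| q * j by apply: pfactor_dvdnn.
  rewrite Gauss_dvdr // coprimeXl //.
  by apply: coprime_dvdl pb co.
rewrite coprimeXl // big_seq.
apply: (big_ind (fun x => coprime p x)) => [|x y cx cy|p' p'l].
- by rewrite coprimen1.
- by rewrite coprimeMr cx.
apply: coprimeXr; have /andP[pr_p' _] := allP al _ p'l.
by rewrite prime_coprime // dvdn_prime2 //; apply: contraNneq p_l => ->.
Qed.

(** Both parts follow from the product of lcm and gcd being [n * g]; they turn Burnside's condition
    on rotations into one on divisors of [n]. *)
Lemma lcmn_gcdn_mulP n g B : 0 < n -> 0 < g -> lcmn n g = n * B ->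
  g = gcdn n g * B /\ coprime (n %/ gcdn n g) B.
Proof.
move=> n_gt0 g_gt0 el; have j_gt0 : 0 < gcdn n g by rewrite gcdn_gt0 n_gt0.
have eg : g = gcdn n g * B.
  by apply/eqP; rewrite -(eqn_pmul2l n_gt0) -muln_lcm_gcd el mulnAC mulnA.
split=> //; rewrite /coprime -(eqn_pmul2l j_gt0) muln_gcdr muln1.
by rewrite mulnC divnK ?dvdn_gcdl // -eg.
Qed.

(** Rotations are grouped by [j = gcdn n (gcdn r N)]. The lcm condition forces
    [gcdn r N = j * b ^ K], which holds for [totient (n %/ j)] rotations, and the coprimality it
    imposes is [d_part b n %| j]. *)
Lemma sum_lcmn_gcdn b K n (F : nat -> nat) : 0 < b -> 0 < K -> 0 < n ->
  \sum_(r < n * b ^ K)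
    (if lcmn n (gcdn r (n * b ^ K)) == n * b ^ K
     then F (gcdn n (gcdn r (n * b ^ K))) else 0) =
  \sum_(1 <= j < n.+1 | (d_part b n %| j) && (j %| n)) F j * totient (n %/ j).
Proof.
move=> b_gt0 K_gt0 n_gt0; set N := n * _.
have B_gt0 : 0 < b ^ K by rewrite expn_gt0 b_gt0.
have N_gt0 : 0 < N by rewrite muln_gt0 n_gt0.
have g_gt0 r : 0 < gcdn r N by rewrite gcdn_gt0 N_gt0 orbT.
have lt_j r : gcdn n (gcdn r N) < n.+1 by rewrite ltnS dvdn_leq // dvdn_gcdl.
rewrite -big_mkcond big_geq_mkord /=.
rewrite (partition_big (fun r : 'I_N => Ordinal (lt_j r))
   (fun j : 'I_n.+1 => (d_part b n %| j) && (j %| n) && (0 < j))) /=; last first.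
  move=> r /eqP/(lcmn_gcdn_mulP n_gt0 (g_gt0 r))[_ co].
  rewrite d_part_dvd ?dvdn_gcdl //= coprime_sym -(coprime_pexpr _ _ K_gt0) co.
  by rewrite gcdn_gt0 n_gt0.
apply: eq_bigr => j /andP[/andP[dj jn] j_gt0].
have co : coprime (n %/ j) (b ^ K).
  by rewrite coprime_pexpr // coprime_sym -d_part_dvd.
rewrite (eq_bigr (fun=> F j)); last by move=> r /andP[_ /eqP<-].
rewrite sum_nat_const mulnC; congr (_ * _).
have -> : n %/ j = N %/ (j * b ^ K) by rewrite divnMr.
rewrite -card_gcdn_eq //; last by rewrite dvdn_pmul2r.
apply: eq_card => r; rewrite inE unfold_in -val_eqE /=.
apply/andP/eqP => [[/eqP/(lcmn_gcdn_mulP n_gt0 (g_gt0 r))[eg _] /eqP ej]|->].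
  by rewrite eg ej.
have ej : gcdn n (j * b ^ K) = j.
  by rewrite -{1}(divnK jn) mulnC -muln_gcdr (eqP co) muln1.
split; last by rewrite ej.
have := muln_lcm_gcd n (j * b ^ K); rewrite ej => elcm.
by rewrite -(eqn_pmul2r j_gt0) elcm /N mulnAC mulnA.
Qed.

(** In Burnside's sum a rotation with gcd [g] fixes no perfect word unless [lcmn n g] is the full
    length; then it fixes as many as there are perfect words for [gcdn n g]. *)
Lemma card_perfect_necklaces (A : finType) k n : 0 < #|A| -> 0 < n ->
  #|perfect_necklaces A k.+1 n| * (n * #|A| ^ k.+1) =
  \sum_(1 <= j < n.+1 | (d_part #|A| n %| j) && (j %| n))
     #|A|`! ^ (j * #|A| ^ k) * totient (n %/ j).
Proof.
move=> A_gt0 n_gt0; case/card_gt0P: (A_gt0) => a0 _.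
have N_gt0 : 0 < n * #|A| ^ k.+1 by rewrite muln_gt0 n_gt0 expn_gt0 A_gt0.
rewrite card_necklaces_pred //; last by move=> i s lt_i; apply: perfect_word_rot.
rewrite -(sum_lcmn_gcdn (fun j => #|A|`! ^ (j * #|A| ^ k)) A_gt0 (ltn0Sn k) n_gt0).
apply: eq_bigr => r _; set g := gcdn r _.
have g_gt0 : 0 < g by rewrite gcdn_gt0 N_gt0 orbT.
case: eqP => [lcmN|ne_lcm]; last first.
  apply/eqP; rewrite cards_eq0; apply/eqP/setP => s; rewrite !inE.
  apply/negP => /andP[Ps /(rot_fixedP a0 s N_gt0 (ltn_ord r)) per].
  by case: ne_lcm; apply: (perfect_word_lcm n_gt0 _ Ps per); apply: dvdn_gcdr.
rewrite -(card_perfect_words a0) ?gcdn_gt0 ?n_gt0 //.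
rewrite -(card_periodic_perfect_words a0 n_gt0 g_gt0 lcmN).
apply: eq_card => s; rewrite !inE; congr (_ && _).
apply/(rot_fixedP a0 s N_gt0 (ltn_ord r))/forallP => [per i|per i].
  by rewrite per modn_small.
have lt_i : i %% (n * #|A| ^ k.+1) < n * #|A| ^ k.+1 by rewrite ltn_pmod.
by rewrite -(eqP (per (Ordinal lt_i))) /= modnDml.
Qed.

Theorem theorem3p13 (A : finType) (k n : nat)
  (hA : 2 <= #|A|) (hk : 0 < k) (hn : 0 < n) :
  (#|perfect_necklaces A k n|%:R =
     n%:R^-1 * \sum_(1 <= j < n.+1 | (d_part #|A| n %| j)%N && (j %| n)%N)
                 e_num #|A| k j * (totient (n %/ j)%N)%:R :> rat)%R
  /\ (forall j : nat, 0 < j -> d_part #|A| n %| j -> j %| n ->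
       (#|eulerian_circuits (astute_graph A k.-1 j)|%:R = e_num #|A| k j
          :> rat)%R).
Proof.
have A_gt0 : 0 < #|A| := ltnW hA.
case: k hk => // k _.
have bK0 : ((#|A|%:R : rat) ^+ k.+1 != 0)%R.
  by rewrite expf_neq0 // pnatr_eq0 -lt0n.
have n0 : (n%:R != 0 :> rat)%R by rewrite pnatr_eq0 -lt0n.
split=> [|j j_gt0 _ _]; last first.
  apply: (mulIf bK0); rewrite /e_num divfK // -!natrX -natrM.
  by rewrite card_astute_circuits.
(* Multiplying by [n * #|A| ^ k.+1] clears all denominators and reduces the claim to the count over
   the naturals. *)
apply: (mulIf bK0); apply: (mulfI n0); rewrite mulrCA -natrX -!natrM.
rewrite card_perfect_necklaces // natr_sum natrX -mulrA mulVKf // mulr_suml.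
by apply: eq_bigr => j _; rewrite /e_num mulrAC divfK // natrM natrX.
Qed.
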